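(* Let $(V_o,w_o,\mu_o)$ be a simple weighted graph with adapted weight $\sigma_o$, let $\bar x\in V_o$, and let $(V,w,\mu)$ be the modified graph of $(V_o,w_o,\mu_o)$ with weight $\mathfrak n$. Assume that the Markov chain $(X_t)_{t\ge0}$ of $(V,w,\mu)$ is conservative. Let \[\mathcal A_t=\int_0^t\mathbf 1_{V_o}(X_s)\,ds,\qquad \tau_t=\inf\{s>0:\mathcal A_s>t\}.\] Then there exists a constant $C>1$, independent of $(V_o,w_o,\mu_o)$, $\sigma_o$ and $\mathfrak n$, such that for some random time $\tilde T$, \[\mathbb P_{\bar x}\big(\tau_t\le Ct\ \text{for all } t\ge\tilde T\big)=1.\]
   Context: **Weighted graphs and chains.** A simple weighted graph $(V,w,\mu)$ consists of a countably infinite set $V$, a symmetric function $w:V\times V\to[0,\infty)$ and a function $\mu:V\to(0,\infty)$. The graph with edges $\{x\sim y:w(x,y)>0\}$ is assumed to be locally finite, connected, and without loops or multiple edges. Its Markov chain is the minimal continuous-time Markov chain with $Q$-matrix $q_{xy}=w(x,y)/\mu(x)$ for $x\ne y$ and $q_{xx}=-\frac1{\mu(x)}\sum_y w(x,y)$, with lifetime $\zeta$ and laws $\mathbb P_x$. It is conservative if $\mathbb P_x(\zeta<\infty)=0$ for all $x$. An adapted weight is a symmetric $\sigma:E\to(0,1]$ with $\frac1{\mu(x)}\sum_y w(x,y)\sigma(x,y)^2\le1$ for all $x$. **Modified graph.** Fix an orientation $E_o^+\subset E_o$ of the edge set of $(V_o,w_o,\mu_o)$, containing exactly one of $(x,y)$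 and $(y,x)$ for each edge. Let $\mathfrak n:E_o\to\mathbb N_+$ be symmetric with $\mathfrak n\ge2$. For each $e=(x,y)\in E_o^+$, add $\mathfrak n(e)-1$ distinct new vertices $V_e=\{x^e_1,\dots,x^e_{\mathfrak n(e)-1}\}$, and put $x_0^e=x$, $x^e_{\mathfrak n(e)}=y$. Replace the edge $x\sim y$ by the path $x_0^e\sim x_1^e\sim\cdots\sim x^e_{\mathfrak n(e)}$. The new vertex set is $V=V_o\cup\bigcup_e V_e$. Set $w(x_i^e,x_{i+1}^e)=w(x_{i+1}^e,x_i^e)=\mathfrak n(e)w_o(e)$ for $0\le i\le\mathfrak n(e)-1$, and $w=0$ otherwise. Set $\mu|_{V_o}=\mu_o$ and $\mu(x_i^e)=2w_o(e)\sigma_o(e)^2/\mathfrak n(e)$ for $1\le i\le\mathfrak n(e)-1$. The new adapted weight is $\sigma(x_i^e,x_{i+1}^e)=\sigma_o(e)/\mathfrak n(e)$. *)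

(* Defs.v *)
From HB Require Import structures.
From mathcomp Require Import all_boot all_order all_algebra.
From mathcomp Require Import all_classical all_reals all_analysis.
Set Implicit Arguments. Unset Strict Implicit. Unset Printing Implicit Defensive.
Import Order.TTheory GRing.Theory Num.Theory.
Local Open Scope classical_set_scope.
Local Open Scope ring_scope.

(* Generic weighted graph (V, w, mu) and its (minimal) Markov chain,    *)
(* described through its jump chain and holding times.                  *)
Section Chain.
Variables (R : realType) (V : choiceType) (w : V -> V -> R) (mu : V -> R).

Definition wdeg (x : V) : R := fine (\esum_(y in [set: V]) (w x y)%:E).
(* jump probabilities q_xy / (-q_xx) = w(x,y) / sum_z w(x,z) *)
Definition jprob (x y : V) : R := w x y / wdeg x.
(* total jump rate -q_xx = (1/mu(x)) sum_y w(x,y) *)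
Definition jrate (x : V) : R := wdeg x / mu x.

Definition jtime {Omega : Type} (H : nat -> Omega -> R) (k : nat) (om : Omega) : R :=
  \sum_(i < k) H i om.

(* (Y, H) is a realization of the minimal chain started at x0 on the
   probability space P: Y k is the k-th state of the jump chain, H k the
   holding time in state Y k.  The joint law is determined by
   P(Y_0 = x_0, ..., Y_n = x_n, H_0 > s_0, ..., H_n > s_n)
     = 1_{x_0 = x0} prod_{i<n} p(x_i,x_{i+1}) prod_{i<=n} exp(-q(x_i) s_i). *)
Definition chain_realization {d : measure_display} {Omega : measurableType d}
    (P : probability Omega R) (x0 : V)
    (Y : nat -> Omega -> V) (H : nat -> Omega -> R) : Prop :=
  [/\ (forall k (y : V), measurable (Y k @^-1` [set y])),
      (forall k, measurable_fun setT (H k)),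
      P [set om | Y 0 om = x0] = 1%E &
      forall (n : nat) (x : nat -> V) (s : nat -> R),
        x 0 = x0 -> (forall i, 0 <= s i) ->
        P [set om | forall i, (i <= n)%N -> Y i om = x i /\ s i < H i om]
        = ((\prod_(i < n) jprob (x i) (x i.+1))
            * \prod_(i < n.+1) expR (- (jrate (x i) * s i)))%:E ].

Definition explodes {Omega : Type} (H : nat -> Omega -> R) (om : Omega) : Prop :=
  exists M : R, forall k, jtime H k om <= M.

(* X_t(om) \in B  (with X_t defined for t < zeta) *)
Definition chain_in {Omega : Type} (Y : nat -> Omega -> V) (H : nat -> Omega -> R)
    (B : set V) (om : Omega) (t : R) : Prop :=
  exists k, jtime H k om <= t < jtime H k.+1 om /\ B (Y k om).

Definition conservative : Prop :=
  forall (x : V) (d : measure_display) (Omega : measurableType d)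
    (P : probability Omega R) (Y : nat -> Omega -> V) (H : nat -> Omega -> R),
    chain_realization P x Y H -> P [set om | explodes H om] = 0%E.

Definition occupation {Omega : Type} (Y : nat -> Omega -> V) (H : nat -> Omega -> R)
    (B : set V) (om : Omega) (t : R) : \bar R :=
  (\int[@lebesgue_measure R]_(s in `[0%R, t]) (\1_[set u | chain_in Y H B om u] s)%:E)%E.

Definition time_change {Omega : Type} (Y : nat -> Omega -> V) (H : nat -> Omega -> R)
    (B : set V) (om : Omega) (t : R) : \bar R :=
  ereal_inf [set s%:E | s in [set s : R | 0 < s /\ (t%:E < occupation Y H B om s)%E]].

End Chain.

Section Graph.
Variables (R : realType) (V : countType) (w : V -> V -> R) (mu : V -> R).

Definition simple_weighted_graph : Prop :=
  ~ finite_set [set: V] /\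
  (forall x y, w x y = w y x) /\
  (forall x y, 0 <= w x y) /\
  (forall x, 0 < mu x) /\
  (forall x, w x x = 0) /\
  (forall x, finite_set [set y | w x y != 0]) /\
  (forall x y, exists s : seq V,
      path (fun a b => 0 < w a b) x s /\ last x s = y).

Definition adapted_weight (sigma : V -> V -> R) : Prop :=
  [/\ (forall x y, 0 < w x y -> sigma x y = sigma y x),
      (forall x y, 0 < w x y -> 0 < sigma x y <= 1)
    & (forall x, (((mu x)^-1)%:E
          * (\esum_(y in [set: V]) (w x y * sigma x y ^+ 2)%:E) <= 1)%E)].

Definition orientation (pos : rel V) : Prop :=
  (forall x y, pos x y -> 0 < w x y) /\
  (forall x y, 0 < w x y -> pos x y = ~~ pos y x).

End Graph.

(* The modified graph.  The vertex inl x is x in V_o; the vertex        *)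
(* inr (x, y, i) is x^e_i for the oriented edge e = (x, y) in E_o^+,    *)
(* 1 <= i <= n(e) - 1.                                                   *)
Section Modified.
Variables (R : realType) (Vo : countType) (wo : Vo -> Vo -> R) (muo : Vo -> R)
  (sigmao : Vo -> Vo -> R) (pos : rel Vo) (nn : Vo -> Vo -> nat).

Definition mvalid (v : Vo + (Vo * Vo * nat)) : bool :=
  match v with
  | inl _ => true
  | inr (x, y, i) => pos x y && (0 < i < nn x y)%N
  end.

Definition mvert := {v : Vo + (Vo * Vo * nat) | mvalid v}.
HB.instance Definition _ := Countable.copy mvert {v : Vo + (Vo * Vo * nat) | mvalid v}.

Definition mw_raw (u v : Vo + (Vo * Vo * nat)) : R :=
  match u, v with
  | inl _, inl _ => 0
  | inl a, inr (x, y, i) | inr (x, y, i), inl a =>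
      if ((a == x) && (i == 1)%N) || ((a == y) && (i == (nn x y).-1)%N)
      then (nn x y)%:R * wo x y else 0
  | inr (x, y, i), inr (x', y', j) =>
      if (x == x') && (y == y') && ((i == j.+1)%N || (j == i.+1)%N)
      then (nn x y)%:R * wo x y else 0
  end.

Definition mw (u v : mvert) : R := mw_raw (val u) (val v).

Definition mmu (v : mvert) : R :=
  match val v with
  | inl a => muo a
  | inr (x, y, _) => 2 * wo x y * sigmao x y ^+ 2 / (nn x y)%:R
  end.

Definition in_Vo : set mvert := [set v | exists a, val v = inl a].

End Modified.

Arguments mw [R Vo] wo pos nn u v.
Arguments mmu [R Vo] wo muo sigmao pos nn v.
Arguments in_Vo [Vo] pos nn _.
Arguments mvalid [Vo] pos nn v.

(* Main.v *)
Require Import Defs.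
From HB Require Import structures.
From mathcomp Require Import all_boot all_order all_algebra.
From mathcomp Require Import all_classical all_reals all_analysis.
From mathcomp Require Import measurable_realfun.
From mathcomp Require Import zify ring lra.
Set Implicit Arguments. Unset Strict Implicit. Unset Printing Implicit Defensive.
Import Order.TTheory GRing.Theory Num.Theory.
Import numFieldNormedType.Exports.
Local Open Scope classical_set_scope.
Local Open Scope ring_scope.

(** Give the clock rate [c = -4] on [V_o] and [c = 1] on the subdivision
    vertices, let [S_k] be the accumulated value of [c] along the chain up to
    its [k]-th jump and [Z_k = exp S_k].  With [u = 1] on [V_o] and
    [u = 1 + 2 sigma^2 i (n - i) / n^2] at the [i]-th vertex of a subdivided
    edge, adaptedness of [sigma_o] gives the drift inequality
    [L u + c u <= - |c| / 2] for the generator [L].  Hence [E (Z_k u (Y_k))]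
    decreases by at least [E |Z_{k+1} - Z_k| / 2] at each jump, so [Z] has
    finite variation almost surely and [S_k] is bounded above: the time spent
    outside [V_o] is at most four times the time spent in [V_o], plus a random
    constant.  Non-explosion turns this into [tau_t <= 6 t] for large [t]. *)

(** * Exponential holding times *)

(** The primitive [Num.sg c * expR (c * s)] of [|c| exp (c s)] covers both signs of [c]; its
    increment over [[0, h]] is nonnegative, hence the absolute value. *)
Lemma integral_expR_itv (R : realType) (c h : R) : 0 < h ->
  (\int[@lebesgue_measure R]_(s in `[0%R, h]) (`|c| * expR (c * s))%:E)%E
  = `|expR (c * h) - 1|%:E.
Proof.
move=> h0.
have dF (x : R) : is_derive x 1 (fun s : R => Num.sg c * expR (c * s)) (`|c| * expR (c * x)).
  apply: is_derive_eq; rewrite /GRing.scale /=.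
  by rewrite normrEsg; ring.
have cF : continuous (fun s : R => Num.sg c * expR (c * s)).
  by move=> x; apply: differentiable_continuous; exact/derivable1_diffP.
rewrite (@continuous_FTC2 _ _ (fun s => Num.sg c * expR (c * s)))//.
- rewrite mulr0 expR0 mulr1 -EFinB; congr EFin.
  have [c0|c0|->] := ltrgt0P c; last by rewrite mul0r expR0 sgr0 !mul0r !subrr normr0.
  + by rewrite gtr0_sg // mul1r ger0_norm // subr_ge0 -expR0 ler_expR mulr_ge0 // ltW.
  + rewrite ltr0_sg // mulN1r ler0_norm ?subr_le0 -?expR0 ?ler_expR ?expR0; first by ring.
    by rewrite nmulr_rle0 // ltW.
- apply: continuous_subspaceT => x; apply: differentiable_continuous.
  exact/derivable1_diffP.
- split=> [x _||].
  + exact: ex_derive.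
  + by apply: cvg_at_right_filter; exact: cF.
  + by apply: cvg_at_left_filter; exact: cF.
- by move=> x _; rewrite derive1E; apply: derive_val.
Qed.

Lemma integral_expRN_itv (R : realType) (a : R) : 0 < a ->
  (\int[@lebesgue_measure R]_(s in `[0%R, +oo[) (expR (- (a * s)))%:E)%E = (a^-1)%:E.
Proof.
move=> a0.
have /(congr1 (fun x => (a^-1)%:E * x)%E) := integral_exponential_pdf a0.
rewrite mule1 => <-; rewrite -ge0_integralZl//; last first.
- by rewrite lee_fin invr_ge0 ltW.
- by move=> x _; rewrite lee_fin exponential_pdf_ge0 // ltW.
- by apply/measurable_EFinP; exact: measurable_exponential_pdf.
rewrite [LHS]integral_mkcond. apply: eq_integral => x _.
rewrite /exponential_pdf !patchE; case: ifP => _; last by rewrite mule0.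
by rewrite -EFinM mulrA mulVf ?gt_eqF// mul1r mulNr.
Qed.

Section exponential_holding_time.
Context {R : realType} {d : measure_display} {Omega : measurableType d}.
Variables (P : probability Omega R) (f H : Omega -> R) (kappa q : R).
Hypotheses (f0 : forall om, 0 <= f om) (mf : measurable_fun setT f)
  (mH : measurable_fun setT H)
  (fH : forall t : R, 0 <= t ->
    (\int[P]_(om in [set om | (t < H om)%R]) (f om)%:E)%E = (kappa * expR (- (q * t)))%:E).

Lemma measurable_holding_gt (t : R) : measurable [set om | t < H om].
Proof.
rewrite -[X in measurable X]setTI.
have -> : [set om | t < H om] = H @^-1` `]t, +oo[.
  by apply/seteqP; split=> x /=; rewrite in_itv/= andbT.
exact: mH.
Qed.

(* Tonelli applied to [|exp (c h) - 1| = \int_0^h |c| exp (c s) ds]. *)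
Lemma integral_holding_dist (c : R) : c < q ->
  (\int[P]_(om in [set om | (0 < H om)%R]) (f om * `|expR (c * H om) - 1|)%:E)%E
  = (kappa * (`|c| / (q - c)))%:E.
Proof.
move=> cq; have qc0 : 0 < q - c by rewrite subr_gt0.
pose A : set (Omega * R) := [set z | (0 <= z.2) && (z.2 < H z.1)].
have mA : measurable A.
  have mb : measurable_fun setT (fun z : Omega * R => (0 <= z.2) && (z.2 < H z.1)).
    apply: measurable_and.
      by apply: measurable_fun_ler => //; exact: measurable_snd.
    apply: measurable_fun_ltr; first exact: measurable_snd.
    exact: measurableT_comp measurable_fst.
  by rewrite -[A]setTI; exact: (mb measurableT [set true]).
pose F (z : Omega * R) : \bar R := (f z.1 * (`|c| * expR (c * z.2)) * \1_A z)%:E.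
have mF : measurable_fun setT F.
  apply/measurable_EFinP; apply: measurable_funM; last exact: measurable_indic.
  apply: measurable_funM; first exact: measurableT_comp measurable_fst.
  apply: measurable_funM => //; apply: measurableT_comp => //.
  by apply: measurable_funM => //; exact: measurable_snd.
have F0 z : (0 <= F z)%E by rewrite lee_fin !mulr_ge0 // expR_ge0.
have := @fubini_tonelli _ _ _ _ _ P lebesgue_measure F mF F0.
have -> : (\int[P]_x \int[lebesgue_measure]_y F (x, y)
  = \int[P]_(om in [set om | (0 < H om)%R]) (f om * `|expR (c * H om) - 1|)%:E)%E.
  rewrite [RHS]integral_mkcond; apply: eq_integral => om _.
  rewrite patchE; case: ifPn => [|].
    rewrite inE /= => H0.
    have mc : measurable_fun setT (fun s : R => `|c| * expR (c * s)).
      apply: measurable_funM => //; apply: measurableT_comp => //.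
    rewrite EFinM -(@integral_expR_itv _ _ _ H0) -ge0_integralZl_EFin//.
    - rewrite -integral_itv_bndo_bndc//; last first.
        apply: measurable_funeM; apply/measurable_EFinP; exact: measurable_funTS.
      rewrite [RHS]integral_mkcond; apply: eq_integral => s _.
      rewrite patchE /F /= indicE; case: ifPn.
        by rewrite inE/= in_itv/= => sH; rewrite mem_set //= mulr1 EFinM.
      rewrite notin_setE/= in_itv/= => sH.
      by rewrite memNset ?mulr0 //=.
    - by apply/measurable_EFinP; exact: measurable_funTS.
  rewrite notin_setE/= => H0; apply: integral0_eq => s _.
  rewrite /F indicE memNset ?mulr0//= => /andP[s0 sH].
  by apply: H0; exact: le_lt_trans sH.
move=> ->.
(* In the other order [s] is fixed, and the tail hypothesis turns the integral over [om] into
   [kappa |c| exp (- (q - c) s)], integrable because [c < q]. *)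
transitivity (\int[@lebesgue_measure R]_(s in `[0%R, +oo[)
   ((kappa * `|c|)%:E * (expR (- ((q - c) * s)))%:E))%E; last first.
  rewrite ge0_integralZl//=.
  - by rewrite integral_expRN_itv // -EFinM mulrA.
  - apply/measurable_EFinP; apply: measurable_funTS; apply: measurableT_comp => //.
    by apply: measurableT_comp => //; apply: measurable_funM.
  - rewrite lee_fin mulr_ge0 //.
    (* [kappa >= 0] is read off the tail hypothesis at [t = 0]. *)
    have := fH (lexx 0); rewrite mulr0 oppr0 expR0 mulr1 => /esym K.
    by rewrite -lee_fin K; apply: integral_ge0 => om _; rewrite lee_fin.
rewrite [RHS]integral_mkcond; apply: eq_integral => s _.
rewrite patchE; case: ifPn.
  rewrite inE/= in_itv/= andbT => s0.
  transitivity ((`|c| * expR (c * s))%:E * \int[P]_(om in [set om | (s < H om)%R]) (f om)%:E)%E.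
    have mt := measurable_holding_gt s.
    have me : measurable_fun [set om | s < H om] (EFin \o f).
      by apply/measurable_EFinP; exact: measurable_funTS.
    rewrite -ge0_integralZl_EFin ?mulr_ge0 ?expR_ge0//; last first.
      by move=> om _; rewrite lee_fin.
    rewrite [RHS]integral_mkcond; apply: eq_integral => om _.
    rewrite patchE /F indicE/=; case: ifPn.
      rewrite inE/= => sH; rewrite mem_set /A/= ?s0// mulr1 -EFinM.
      by congr EFin; ring.
    rewrite notin_setE/= => sH; rewrite memNset ?mulr0// /A/= => /andP[_].
    exact: sH.
  rewrite (fH s0) -!EFinM; congr EFin.
  have -> : - ((q - c) * s) = c * s + - (q * s) by ring.
  by rewrite expRD; ring.
rewrite notin_setE/= in_itv/= andbT => s0; apply: integral0_eq => om _.
by rewrite /F indicE memNset ?mulr0// /A/= => /andP[].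
Qed.

(** On [0 < H], [exp (c H)] is [1 + |exp (c H) - 1|] or [1 - |exp (c H) - 1|] according to the sign
    of [c], so the previous integral gives the exponential moment. For [c < 0] the subtraction is
    legitimate because the two integrals add up to the finite [kappa]. *)
Lemma integral_holding_expR (c : R) : c < q ->
  (\int[P]_(om in [set om | (0 < H om)%R]) (f om * expR (c * H om))%:E)%E
  = (kappa * (q / (q - c)))%:E.
Proof.
move=> cq; have qc0 : q - c != 0 by rewrite gt_eqF // subr_gt0.
have mD : measurable [set om | 0 < H om] by exact: measurable_holding_gt.
have mE : measurable_fun setT (fun om => f om * expR (c * H om)).
  apply: measurable_funM => //; apply: measurableT_comp => //.
  by apply: measurable_funM.
have mA : measurable_fun setT (fun om => f om * `|expR (c * H om) - 1|).
  apply: measurable_funM => //; apply: measurableT_comp => //.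
  apply: measurable_funB => //; apply: measurableT_comp => //.
  by apply: measurable_funM.
have I1 := integral_holding_dist cq.
have I0 := fH (lexx 0); rewrite mulr0 oppr0 expR0 mulr1 in I0.
have E0 om : [set om | 0 < H om] om -> (0 <= (f om * expR (c * H om))%:E)%E.
  by rewrite lee_fin mulr_ge0 // expR_ge0.
have A0 om : [set om | 0 < H om] om -> (0 <= (f om * `|expR (c * H om) - 1|)%:E)%E.
  by rewrite lee_fin mulr_ge0.
have F0 om : [set om | 0 < H om] om -> (0 <= (f om)%:E)%E by rewrite lee_fin.
have [c0|c0] := leP 0 c.
  transitivity (\int[P]_(om in [set om | (0 < H om)%R])
      ((f om)%:E + (f om * `|expR (c * H om) - 1|)%:E))%E.
    apply: eq_integral => om /[!inE]/= H0.
    rewrite -EFinD ger0_norm; first by congr EFin; ring.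
    by rewrite subr_ge0 -expR0 ler_expR mulr_ge0 // ltW.
  rewrite ge0_integralD //; last 2 first.
  - by apply/measurable_EFinP; exact: measurable_funTS.
  - by apply/measurable_EFinP; exact: measurable_funTS.
  by rewrite I0 I1 -EFinD ger0_norm //; congr EFin; field.
have: (\int[P]_(om in [set om | (0 < H om)%R])
      ((f om * expR (c * H om))%:E + (f om * `|expR (c * H om) - 1|)%:E) = kappa%:E)%E.
  rewrite -I0; apply: eq_integral => om /[!inE]/= H0.
  rewrite -EFinD ler0_norm; first by congr EFin; ring.
  by rewrite subr_le0 -expR0 ler_expR nmulr_rle0 // ltW.
rewrite ge0_integralD //; last 2 first.
- by apply/measurable_EFinP; exact: measurable_funTS.
- by apply/measurable_EFinP; exact: measurable_funTS.
rewrite I1; case: (integral _ _ _) => [r||] //.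
rewrite -EFinD => -[]; rewrite ltr0_norm // => K; congr EFin.
by rewrite -(addrK (kappa * (- c / (q - c))) r) K; field.
Qed.

End exponential_holding_time.

(** * Sums over a countable state space *)

Section esum_extra.
Local Open Scope ereal_scope.
Context {R : realType} {T : choiceType}.

(** One inequality follows from finite partial sums for every factor; the reverse one is the same
    inequality with factor [k^-1] applied to the family [k * a]. *)
Lemma esumZl (D : set T) (k : R) (a : T -> \bar R) : (0 <= k)%R ->
  (forall i, 0 <= a i) ->
  \esum_(i in D) (k%:E * a i) = k%:E * \esum_(i in D) a i.
Proof.
have le (l : R) (b : T -> \bar R) : (0 <= l)%R -> (forall i, 0 <= b i) ->
    \esum_(i in D) (l%:E * b i) <= l%:E * \esum_(i in D) b i.
  move=> l0 b0; apply: ge_ereal_sup => _ [X XD <-].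
  rewrite -ge0_mule_fsumr //; apply: lee_wpmul2l; first by rewrite lee_fin.
  by apply: ereal_sup_ubound; exists X.
rewrite le_eqVlt => /predU1P[<- a0|k0 a0].
  by rewrite mul0e esum1 // => i _; rewrite mul0e.
have k0' := ltW k0; apply/eqP; rewrite eq_le le //=.
have -> : \esum_(i in D) a i = \esum_(i in D) (k^-1%:E * (k%:E * a i)).
  by apply: eq_esum => i _; rewrite muleA -EFinM mulVf ?gt_eqF // mul1e.
apply: (@le_trans _ _ (k%:E * (k^-1%:E * \esum_(i in D) (k%:E * a i)))).
  apply: lee_wpmul2l; first by rewrite lee_fin.
  by apply: le; [rewrite invr_ge0|move=> i; rewrite mule_ge0 // lee_fin].
by rewrite muleA -EFinM mulfV ?gt_eqF // mul1e.
Qed.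

Lemma esum_exchange {T' : choiceType} (a : T -> T' -> \bar R) :
  (forall i j, 0 <= a i j) ->
  \esum_(i in [set: T]) \esum_(j in [set: T']) a i j
  = \esum_(j in [set: T']) \esum_(i in [set: T]) a i j.
Proof.
move=> a0; rewrite !esum_esum //.
rewrite (reindex_esum ([set: T'] `*`` (fun=> [set: T])) _ (fun z => (z.2, z.1))) //.
split => //=.
- by move=> [i j] [j' i'] _ _ /= [-> ->].
- by move=> [i j] _; exists (j, i).
Qed.

End esum_extra.

Section countable_state.
Context {R : realType} {d : measure_display} {Omega : measurableType d} {V : countType}.
Variables (P : probability Omega R) (Y : Omega -> V).
Hypothesis mY : forall y, measurable (Y @^-1` [set y]).

Lemma measurable_state_set (B : set V) : measurable (Y @^-1` B).
Proof.
have -> : Y @^-1` B = \bigcup_y (Y @^-1` [set y] `&` [set _ | B y]).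
  apply/seteqP; split=> [om By|om [y _ [/= <- //]]].
  by exists (Y om).
apply: countable_bigcupT_measurable => // y.
apply: measurableI => //; have [By|nBy] := pselect (B y).
  by rewrite (_ : [set _ | _] = setT) //; apply/seteqP; split.
by rewrite (_ : [set _ | _] = set0) //; apply/seteqP; split.
Qed.

Lemma measurable_fun_state (F : V -> Omega -> R) :
  (forall x, measurable_fun setT (F x)) -> measurable_fun setT (fun om => F (Y om) om).
Proof.
move=> mF _ B mB; rewrite setTI.
have -> : (fun om => F (Y om) om) @^-1` B = \bigcup_y (Y @^-1` [set y] `&` F y @^-1` B).
  apply/seteqP; split=> [om By|om [y _ [/= <- //]]].
  by exists (Y om).
apply: countable_bigcupT_measurable => // y.
by apply: measurableI => //; rewrite -[X in measurable X]setTI; exact: mF.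
Qed.

(** Countable additivity over the codes [pickle (Y om)]; codes outside the range of [pickle] give
    empty pieces, and the remaining ones are reindexed by states. *)
Lemma integral_state_split (D : set Omega) (f : Omega -> R) :
  measurable D -> measurable_fun setT f -> (forall om, 0 <= f om) ->
  (\int[P]_(om in D) (f om)%:E
   = \esum_(x in [set: V]) \int[P]_(om in D `&` Y @^-1` [set x]) (f om)%:E)%E.
Proof.
move=> mD mf f0.
pose F (n : nat) := D `&` Y @^-1` (pickle @^-1` [set n]).
have mF n : measurable (F n) by apply: measurableI => //; exact: measurable_state_set.
have FD : \bigcup_n F n = D.
  apply/seteqP; split=> [om [n _ []] //|om Dom].
  by exists (pickle (Y om)).
rewrite -{1}FD ge0_integral_bigcup //; last 3 first.
- by rewrite FD; apply/measurable_EFinP; exact: measurable_funTS.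
- by move=> om _; rewrite lee_fin.
- apply/trivIsetP => i j _ _ ij; apply/seteqP; split=> om // [[_ ii] [_ ji]].
  by move: ii ji => /= ii ji; rewrite -ii ji eqxx in ij.
have I0 n : (0 <= \int[P]_(om in F n) (f om)%:E)%E.
  by apply: integral_ge0 => om _; rewrite lee_fin.
rewrite nneseries_esumT //.
transitivity (\esum_(n in range (@pickle V)) \int[P]_(om in F n) (f om)%:E)%E.
  rewrite [RHS]esum_mkcond; apply: eq_esum => n _; case: ifPn => //.
  rewrite notin_setE => nr; rewrite (_ : F n = set0) ?integral_set0 //.
  by apply/seteqP; split=> om //= [_ /= on]; apply: nr; exists (Y om).
rewrite (reindex_esum [set: V] _ pickle).
  apply: eq_esum => x _; congr (integral _ _ _).
  apply/seteqP; split=> om /= [Dom].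
    by move=> /(pcan_inj (@pickleK V)) <-.
  by move=> <-.
split.
- by move=> x _; exists x.
- by move=> x y _ _ /(pcan_inj (@pickleK V)).
- by move=> n [x _ <-]; exists x.
Qed.

End countable_state.

(** * Feynman-Kac weights of the jump chain *)

Section feynman_kac.
Context {R : realType} {d : measure_display} {Omega : measurableType d} {V : countType}.
Variables (P : probability Omega R) (x0 : V) (p : V -> V -> R) (q : V -> R).
Variables (Y : nat -> Omega -> V) (H : nat -> Omega -> R) (c : V -> R).

(* The realization law only speaks about [s i < H i] with [0 <= s i]; hence the
   factors [0 < H i] in the weights below. *)
Definition holding_window (k n : nat) (z : nat -> V) (s : nat -> R) : set Omega :=
  [set om | forall i, (k <= i <= n)%N -> Y i om = z i /\ s i < H i om].

(** This is [Z_k = exp S_k] on the event that the first [k] holding times are positive, and 0 off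
    it. *)
Fixpoint fk_weight (k : nat) (om : Omega) : R :=
  if k is k'.+1 then
    fk_weight k' om * (expR (c (Y k' om) * H k' om) * (0 < H k' om)%R%:R)
  else 1.

(* [fk_mass k y] is the expectation of [fk_weight k] on [Y k = y, 0 < H k]. *)
Fixpoint fk_mass (k : nat) (y : V) : \bar R :=
  if k is k'.+1 then
    (\esum_(x in [set: V]) (fk_mass k' x * (q x / (q x - c x) * p x y)%:E))%E
  else ((y == x0)%:R)%:E.

Hypotheses (p0 : forall x y, 0 <= p x y) (q0 : forall x, 0 <= q x)
  (cq : forall x, c x < q x)
  (mY : forall k y, measurable (Y k @^-1` [set y]))
  (mH : forall k, measurable_fun setT (H k))
  (law : forall n z (s : nat -> R), (forall i, 0 <= s i) ->
    P (holding_window 0 n z s)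
    = ((z 0 == x0)%:R * (\prod_(0 <= i < n) p (z i) (z i.+1)
       * \prod_(0 <= i < n.+1) expR (- (q (z i) * s i))))%:E).

(** On [0 < H k] this is [|Z_{k+1} - Z_k|], the factor [Z_k] being nonnegative. *)
Definition fk_increment k om : R :=
  fk_weight k om * `|expR (c (Y k om) * H k om) - 1| * (0 < H k om)%R%:R.

Lemma measurable_holding_pos k : measurable_fun setT (fun om => (0 < H k om)%R%:R : R).
Proof.
have -> : (fun om => (0 < H k om)%R%:R) = \1_[set om | 0 < H k om] :> (Omega -> R).
  apply/funext => om; rewrite indicE; congr ((nat_of_bool _)%:R).
  by apply/idP/idP => [h|/set_mem //]; apply/mem_set.
exact/measurable_indic/measurable_holding_gt.
Qed.

Lemma measurable_fk_factor k : measurable_fun setT (fun om => expR (c (Y k om) * H k om)).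
Proof.
apply: measurableT_comp => //.
apply: (@measurable_fun_state _ _ _ _ (Y k) (mY k) (fun x om => c x * H k om)) => x.
by apply: measurable_funM.
Qed.

Lemma measurable_fk_weight k : measurable_fun setT (fk_weight k).
Proof.
elim: k => [|k IH] //=; apply: measurable_funM => //.
by apply: measurable_funM; [exact: measurable_fk_factor|exact: measurable_holding_pos].
Qed.

Lemma measurable_fk_increment k : measurable_fun setT (fk_increment k).
Proof.
apply: measurable_funM; last exact: measurable_holding_pos.
apply: measurable_funM; first exact: measurable_fk_weight.
apply: measurableT_comp => //; apply: measurable_funB => //.
exact: measurable_fk_factor.
Qed.

Lemma fk_weight_ge0 k om : 0 <= fk_weight k om.
Proof. by elim: k => [|k IH] //=; rewrite !mulr_ge0 // expR_ge0. Qed.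

Lemma fk_increment_ge0 k om : 0 <= fk_increment k om.
Proof. by rewrite !mulr_ge0 // fk_weight_ge0. Qed.

Lemma fk_step_ge0 x y : 0 <= q x / (q x - c x) * p x y.
Proof. by rewrite !mulr_ge0 // invr_ge0 subr_ge0 ltW. Qed.

Lemma fk_mass_ge0 k y : (0 <= fk_mass k y)%E.
Proof.
elim: k y => [|k IH] y /=; first by rewrite lee_fin.
by apply: esum_ge0 => x _; rewrite mule_ge0 // lee_fin fk_step_ge0.
Qed.

(** * Law of the chain under the Feynman-Kac weight *)

Lemma measurable_holding_window k n z s : measurable (holding_window k n z s).
Proof.
have -> : holding_window k n z s
  = \bigcap_(i in [set i | (k <= i <= n)%N]) (Y i @^-1` [set z i] `&` [set om | s i < H i om]).
  by apply/seteqP; split=> om.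
apply: bigcap_measurableType => // i _; apply: measurableI => //.
exact: measurable_holding_gt.
Qed.

(** The past weight and the events after step [k] are fixed while [H k] stays free; this is the
    density [f] to which the exponential holding time section applies. *)
Definition fk_window_weight k n z s x om : R :=
  fk_weight k om * \1_(holding_window k.+1 n z s `&` Y k @^-1` [set x]) om.

Lemma fk_window_weight_ge0 k n z s x om : 0 <= fk_window_weight k n z s x om.
Proof. by rewrite mulr_ge0 // fk_weight_ge0. Qed.

Lemma measurable_fk_window_weight k n z s x :
  measurable_fun setT (fk_window_weight k n z s x).
Proof.
apply: measurable_funM; first exact: measurable_fk_weight.
by apply/measurable_indic/measurableI => //; exact: measurable_holding_window.
Qed.

(** The product in the law from step [k] on, with state [x] at step [k] and without the exponential
    factor of [H k], which becomes the tail in [t]. *)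
Definition window_mass k n z s x : R :=
  (\prod_(k <= i < n) p (if i == k then x else z i) (z i.+1))
  * \prod_(k.+1 <= i < n.+1) expR (- (q (z i) * s i)).

(** A weighted Markov property: the past of step [k] enters only through [fk_mass k (z k)], and the
    future keeps its product form. *)
Definition fk_law k := forall n z (s : nat -> R), (k <= n)%N -> (forall i, 0 <= s i) ->
  (\int[P]_(om in holding_window k n z s) (fk_weight k om)%:E
   = fk_mass k (z k) * (\prod_(k <= i < n) p (z i) (z i.+1)
       * \prod_(k <= i < n.+1) expR (- (q (z i) * s i)))%:E)%E.

(** Changing [z] and [s] at the single index [k] to [x] and [t] makes the event an instance of
    [fk_law k]. Thus [H k] has an exponential tail of rate [q x]; finiteness of the mass supplies a
    real constant [kappa]. *)
Lemma fk_window_weight_tail k n z (s : nat -> R) x : fk_law k -> fk_mass k x \is a fin_num ->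
  (k <= n)%N -> (forall i, 0 <= s i) ->
  forall t : R, 0 <= t ->
    (\int[P]_(om in [set om | (t < H k om)%R]) (fk_window_weight k n z s x om)%:E)%E
    = (fine (fk_mass k x) * window_mass k n z s x * expR (- (q x * t)))%:E.
Proof.
move=> Lk Kfin kn s0 t t0.
pose z' i := if i == k then x else z i.
pose s' i := if i == k then t else s i.
have s'0 i : 0 <= s' i by rewrite /s'; case: ifP.
have z'k : z' k = x by rewrite /z' eqxx.
have z'N i : (k < i)%N -> z' i = z i by move=> ki; rewrite /z' gtn_eqF.
have s'N i : (k < i)%N -> s' i = s i by move=> ki; rewrite /s' gtn_eqF.
have winE om : holding_window k n z' s' om <->
    (holding_window k.+1 n z s `&` Y k @^-1` [set x]) om /\ t < H k om.
  split=> [win|[[win Yx] tH] i /andP[]].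
    have [Yk Hk] : Y k om = z' k /\ s' k < H k om by apply: win; rewrite leqnn.
    rewrite /s' eqxx in Hk; rewrite z'k in Yk; split=> //; split=> // i /andP[ki i_n].
    by rewrite -(z'N i) // -(s'N i) //; apply: win; rewrite (ltnW ki).
  rewrite leq_eqVlt => /predU1P[<- _|ki i_n]; first by rewrite z'k /s' eqxx.
  by rewrite z'N // s'N //; apply: win; rewrite ki.
transitivity (\int[P]_(om in holding_window k n z' s') (fk_weight k om)%:E)%E.
  rewrite [LHS]integral_mkcond [RHS]integral_mkcond; apply: eq_integral => om _.
  rewrite !patchE /fk_window_weight indicE.
  have [/[dup] win /winE[w1 tH]|nwin] := pselect (holding_window k n z' s' om).
    by rewrite !mem_set // mulr1.
  rewrite [in RHS]memNset //; case: ifPn => // /set_mem /= tH.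
  by rewrite memNset ?mulr0 // => w1; apply: nwin; apply/winE.
rewrite Lk // z'k -{1}(fineK Kfin) -EFinM; congr EFin; rewrite -mulrA; congr (_ * _).
rewrite /window_mass -mulrA; congr (_ * _).
  by apply: eq_big_nat => i /andP[ki _]; rewrite (z'N i.+1).
rewrite big_ltn // z'k /s' eqxx mulrC; congr (_ * _).
by apply: eq_big_nat => i /andP[ki _]; rewrite z'N // gtn_eqF.
Qed.

(** Integrating out [H k] contributes the exponential moment [q / (q - c)] at the state [x]. *)
Lemma fk_weight_step_integral k n z (s : nat -> R) x : fk_law k -> fk_mass k x \is a fin_num ->
  (k <= n)%N -> (forall i, 0 <= s i) ->
  (\int[P]_(om in holding_window k.+1 n z s `&` Y k @^-1` [set x]) (fk_weight k.+1 om)%:E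
   = (fine (fk_mass k x) * window_mass k n z s x * (q x / (q x - c x)))%:E)%E.
Proof.
move=> Lk Kfin kn s0.
rewrite -(integral_holding_expR (fk_window_weight_ge0 k n z s x)
  (measurable_fk_window_weight k n z s x) (mH k) (fk_window_weight_tail z Lk Kfin kn s0) (cq x)).
rewrite [LHS]integral_mkcond [RHS]integral_mkcond; apply: eq_integral => om _.
rewrite !patchE /fk_window_weight indicE /=.
case: ifPn => [/set_mem [w /= <-]|]; case: ifPn => [/set_mem /= H0|]; rewrite ?mulr0 ?mul0r //.
- by rewrite H0 !mulr1.
- by rewrite notin_setE /= => /negP /negbTE ->; rewrite !mulr0.
Qed.

Lemma fk_increment_integral k : fk_law k -> (forall x, fk_mass k x \is a fin_num) ->
  (\int[P]_om (fk_increment k om)%:E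
   = \esum_(x in [set: V]) (fk_mass k x * (`|c x| / (q x - c x))%:E))%E.
Proof.
move=> Lk Kfin.
rewrite (integral_state_split P (mY k)) //; first apply: eq_esum => x _.
- rewrite setTI.
  (* With [n = k] the window from [k+1] to [n] is empty, so only the condition [Y k = x] remains and
     [window_mass] is 1. *)
  have := integral_holding_dist (fk_window_weight_ge0 k k (fun=> x) (fun=> 0) x)
    (measurable_fk_window_weight k k _ _ x) (mH k)
    (@fk_window_weight_tail k k (fun=> x) (fun=> 0) x Lk (Kfin x) (leqnn _) (fun=> lexx 0)) (cq x).
  rewrite /window_mass !big_geq // !mulr1 EFinM fineK // => <-.
  rewrite [LHS]integral_mkcond [RHS]integral_mkcond; apply: eq_integral => om _.
  rewrite !patchE /fk_increment /fk_window_weight indicE /=.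
  have -> : (om \in holding_window k.+1 k (fun=> x) (fun=> 0) `&` Y k @^-1` [set x])
     = (om \in Y k @^-1` [set x]).
    congr (_ \in _); apply/seteqP; split=> om'; first by case.
    move=> Yx; split=> // i /andP[ki /(leq_trans ki)].
    by rewrite ltnn.
  case: ifPn => [/set_mem /= <-|]; case: ifPn => [/set_mem /= H0|]; rewrite ?mulr0 ?mul0r //.
  + by rewrite H0 !mulr1.
  + by rewrite notin_setE /= => /negP /negbTE ->; rewrite !mulr0.
- exact: measurable_fk_increment.
- exact: fk_increment_ge0.
Qed.

(** Induction on [k]: split according to [Y k = x] and integrate out [H k]; summing over [x]
    reproduces the recursion of [fk_mass]. Only masses at earlier steps have to be finite. *)
Lemma fk_lawP k : (forall j x, (j < k)%N -> fk_mass j x \is a fin_num) -> fk_law k.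
Proof.
elim: k => [_ n z s _ s0|k IH Kfin n z s kn s0].
  rewrite /= integral_cst ?mul1e; last exact: measurable_holding_window.
  by rewrite -EFinM; exact: law.
have Lk : fk_law k by apply: IH => j x jk; apply: Kfin; rewrite ltnS ltnW.
rewrite (integral_state_split P (mY k)); last 3 first.
- exact: measurable_holding_window.
- exact: measurable_fk_weight.
- exact: fk_weight_ge0.
rewrite [RHS]muleC /= -esumZl; last 2 first.
- by rewrite mulr_ge0 // prodr_ge0 // => i _; rewrite expR_ge0.
- by move=> x; rewrite mule_ge0 ?fk_mass_ge0 // lee_fin fk_step_ge0.
apply: eq_esum => x _; rewrite fk_weight_step_integral //; last 2 first.
- exact: Kfin.
- exact: ltnW.
rewrite -{2}[fk_mass k x]fineK; last exact: Kfin.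
rewrite -!EFinM; congr EFin; rewrite /window_mass.
rewrite [in LHS]big_ltn // eqxx; under eq_big_nat => i /andP[ki _] do rewrite gtn_eqF //.
by ring.
Qed.

(** Exchanging the sums moves the transition kernel from the mass onto the test function, where the
    drift inequality can act. *)
Lemma fk_mass_step k (u : V -> R) : (forall y, 0 <= u y) ->
  (forall x, fk_mass k x \is a fin_num) ->
  (\esum_(y in [set: V]) (fk_mass k.+1 y * (u y)%:E)
   = \esum_(x in [set: V]) ((fine (fk_mass k x) / (q x - c x))%:E
       * ((q x)%:E * \esum_(y in [set: V]) (p x y * u y)%:E)))%E.
Proof.
move=> u0 Kfin.
have K0 x : 0 <= fine (fk_mass k x) by rewrite fine_ge0 // fk_mass_ge0.
transitivity (\esum_(y in [set: V]) \esum_(x in [set: V])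
   ((u y)%:E * (fk_mass k x * (q x / (q x - c x) * p x y)%:E)))%E.
  apply: eq_esum => y _; rewrite muleC esumZl // => x.
  by rewrite mule_ge0 ?fk_mass_ge0 // lee_fin fk_step_ge0.
rewrite esum_exchange; last first.
  by move=> y x; rewrite !mule_ge0 ?fk_mass_ge0 // lee_fin ?fk_step_ge0.
apply: eq_esum => x _.
have pu0 y : (0 <= (p x y * u y)%:E)%E by rewrite lee_fin mulr_ge0.
rewrite -esumZl // -esumZl; last 2 first.
- by rewrite divr_ge0 // subr_ge0 ltW.
- by move=> y; rewrite mule_ge0 // lee_fin.
apply: eq_esum => y _; rewrite -[fk_mass k x]fineK // -!EFinM.
by congr EFin; ring.
Qed.

Lemma fk_weight_integral k : fk_law k -> (forall x, fk_mass k x \is a fin_num) ->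
  (\int[P]_om (fk_weight k.+1 om)%:E
   = \esum_(x in [set: V]) (fk_mass k x * (q x / (q x - c x))%:E))%E.
Proof.
move=> Lk Kfin; rewrite (integral_state_split P (mY k)) //; last 2 first.
- exact: measurable_fk_weight.
- exact: fk_weight_ge0.
apply: eq_esum => x _.
have := @fk_weight_step_integral k k (fun=> x) (fun=> 0) x Lk (Kfin x) (leqnn _) (fun=> lexx 0).
rewrite /window_mass !big_geq // !mulr1 EFinM fineK // => <-.
congr integral; congr (_ `&` _); apply/esym/seteqP; split=> om // _ i /andP[ki /(leq_trans ki)].
by rewrite ltnn.
Qed.

(** * Drift inequality and finite variation of the weights *)

Section drift.
Variable u : V -> R.
Hypotheses (u1 : forall x, 1 <= u x)
  (drift : forall x, ((q x)%:E * (\esum_(y in [set: V]) (p x y * u y)%:E)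
     <= ((q x - c x) * u x - `|c x| / 2)%:E)%E).

(** Up to the positivity of holding times, [mass k] stands for [E (Z_k u (Y_k))] and [loss k] for
    [E |Z_{k+1} - Z_k|]. The drift hypothesis is [L u + c u <= - |c| / 2] with
    [L u = q (p u - u)]. *)
Let mass k := (\esum_(x in [set: V]) (fk_mass k x * (u x)%:E))%E.
Let loss k := (\esum_(x in [set: V]) (fk_mass k x * (`|c x| / (q x - c x))%:E))%E.

Let u0 x : 0 <= u x. Proof. exact: le_trans (u1 x). Qed.

Lemma fk_mass_fin k : (mass k < +oo)%E -> forall x, fk_mass k x \is a fin_num.
Proof.
move=> mk x; rewrite ge0_fin_numE ?fk_mass_ge0 //; apply: le_lt_trans mk.
apply: (@le_trans _ _ (fk_mass k x * (u x)%:E)%E).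
  by rewrite -{1}[fk_mass k x]mule1 lee_pmul ?fk_mass_ge0 // lee_fin.
apply: esum_ge; exists [set x]; first by split.
by rewrite fsbig_set1.
Qed.

(** Divided by [q - c > 0], the drift inequality bounds [q / (q - c) p u] by
    [u - |c| / (2 (q - c))], and the subtracted term is half the factor in [loss]. *)
Lemma fk_mass_drift k : (mass k < +oo)%E -> (mass k.+1 + (2^-1)%:E * loss k <= mass k)%E.
Proof.
move=> mk; have Kfin := fk_mass_fin mk.
have K0 x : 0 <= fine (fk_mass k x) by rewrite fine_ge0 // fk_mass_ge0.
have qc0 x : 0 < q x - c x by rewrite subr_gt0.
rewrite /mass /loss fk_mass_step // -esumZl //; last first.
  by move=> x; rewrite mule_ge0 ?fk_mass_ge0 // lee_fin divr_ge0 // ltW.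
rewrite -esumD; last 2 first.
- move=> x _; apply: mule_ge0; first by rewrite lee_fin divr_ge0 // ltW.
  apply: mule_ge0; first by rewrite lee_fin.
  by apply: esum_ge0 => y _; rewrite lee_fin mulr_ge0.
- by move=> x _; rewrite !mule_ge0 ?fk_mass_ge0 // lee_fin divr_ge0 // ltW.
apply: le_esum => x _.
have : fk_mass k x = (fine (fk_mass k x))%:E by rewrite fineK.
move: (K0 x); move: (fine (fk_mass k x)) => kappa kappa0 ->; rewrite -!EFinM.
apply: (@le_trans _ _ ((kappa / (q x - c x))%:E * ((q x - c x) * u x - `|c x| / 2)%:E
   + (2^-1 * (kappa * (`|c x| / (q x - c x))))%:E)%E).
  apply: leeD => //; apply: lee_wpmul2l; last exact: drift.
  by rewrite lee_fin divr_ge0 // ltW.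
rewrite -EFinM -EFinD lee_fin.
rewrite le_eqVlt; apply/orP; left; apply/eqP; field.
by rewrite gt_eqF.
Qed.

(** The induction also provides the finiteness of [mass k] under which the drift step applies. *)
Lemma fk_mass_le k : (mass k <= (u x0)%:E)%E.
Proof.
elim: k => [|k IH].
  rewrite /mass (esumID [set x0]) //; last by move=> x _; rewrite mule_ge0 // ?lee_fin.
  rewrite setTI esum_set1 /= ?eqxx ?mul1e ?lee_fin //.
  rewrite esum1 ?adde0 // => x [_ /= /eqP /negbTE ->]; exact: mul0e.
have mk : (mass k < +oo)%E by apply: le_lt_trans IH _; rewrite ltry.
apply: le_trans IH; apply: le_trans (fk_mass_drift mk).
rewrite leeDl // mule_ge0 ?lee_fin // esum_ge0 // => x _.
by rewrite mule_ge0 ?fk_mass_ge0 // lee_fin divr_ge0 // subr_ge0 ltW.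
Qed.

Lemma fk_mass_fin_num k x : fk_mass k x \is a fin_num.
Proof. by apply: fk_mass_fin; apply: le_lt_trans (fk_mass_le k) _; rewrite ltry. Qed.

Lemma fk_law_drift k : fk_law k.
Proof. by apply: fk_lawP => j x _; exact: fk_mass_fin_num. Qed.

Lemma fk_loss_ge0 k : (0 <= loss k)%E.
Proof.
apply: esum_ge0 => x _.
by rewrite mule_ge0 ?fk_mass_ge0 // lee_fin divr_ge0 // subr_ge0 ltW.
Qed.

(** Telescoping of the drift step; [mass n] is kept on the left so that the induction closes. *)
Lemma fk_loss_sum n : ((2^-1)%:E * \sum_(k < n) loss k + mass n <= (u x0)%:E)%E.
Proof.
elim: n => [|n IH]; first by rewrite big_ord0 mule0 add0e fk_mass_le.
apply: le_trans IH; rewrite big_ord_recr /= ge0_muleDr ?fk_loss_ge0 //; last first.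
  by apply: sume_ge0 => i _; exact: fk_loss_ge0.
rewrite -addeA leeD2l // addeC; apply: fk_mass_drift.
by apply: le_lt_trans (fk_mass_le n) _; rewrite ltry.
Qed.

Definition fk_variation om : \bar R := (\sum_(k <oo) (fk_increment k om)%:E)%E.

Lemma measurable_fk_variation : measurable_fun setT fk_variation.
Proof.
apply: ge0_emeasurable_sum => k.
  by move=> om _ _; rewrite lee_fin fk_increment_ge0.
by move=> _; apply/measurable_EFinP; exact: measurable_fk_increment.
Qed.

Lemma fk_variation_ge0 om : (0 <= fk_variation om)%E.
Proof. by apply: nneseries_ge0 => k _ _; rewrite lee_fin fk_increment_ge0. Qed.

Lemma fk_variation_integral : (\int[P]_om fk_variation om <= (2 * u x0)%:E)%E.
Proof.
rewrite integral_nneseries //; last 2 first.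
- by move=> k; apply/measurable_EFinP; exact: measurable_fk_increment.
- by move=> k om _; rewrite lee_fin fk_increment_ge0.
rewrite (eq_eseriesr (g := loss)); last first.
  by move=> k _; apply: fk_increment_integral; [exact: fk_law_drift|exact: fk_mass_fin_num].
apply: lime_le; first by apply: is_cvg_nneseries => k _ _; exact: fk_loss_ge0.
apply: nearW => n; rewrite big_mkord.
have : ((2^-1)%:E * \sum_(k < n) loss k <= (u x0)%:E)%E.
  apply: le_trans (fk_loss_sum n); rewrite leeDl // esum_ge0 // => x _.
  by rewrite mule_ge0 ?fk_mass_ge0 // lee_fin.
have n2 : (0 <= 2%:E :> \bar R)%E by rewrite lee_fin.
by move=> /(lee_wpmul2l n2); rewrite muleA -!EFinM mulfV // mul1e.
Qed.

Lemma fk_variation_fin : {ae P, forall om, fk_variation om \is a fin_num}.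
Proof.
have /integrable_ae : P.-integrable setT fk_variation.
  apply/integrableP; split; first exact: measurable_fk_variation.
  under eq_integral do rewrite gee0_abs ?fk_variation_ge0 //.
  by apply: le_lt_trans fk_variation_integral _; rewrite ltry.
by move=> /(_ measurableT); apply: filterS => om; apply.
Qed.

(** From [1 + S_k <= exp S_k = Z_k] and [Z_0 = 1], [S_k] is at most the sum of the increments
    [Z_{i+1} - Z_i], hence at most the variation. *)
Lemma fk_sum_le_variation om : (forall k, 0 < H k om) -> fk_variation om \is a fin_num ->
  forall k, \sum_(i < k) c (Y i om) * H i om <= fine (fk_variation om).
Proof.
move=> H0 Vfin k.
have wE j : fk_weight j om = expR (\sum_(i < j) c (Y i om) * H i om).
  elim: j => [|j IH] /=; first by rewrite big_ord0 expR0.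
  by rewrite IH H0 mulr1 big_ord_recr expRD.
apply: (@le_trans _ _ (fk_weight k om - 1)).
  by rewrite wE lerBrDl expR_ge1Dx.
apply: (@le_trans _ _ (\sum_(i < k) fk_increment i om)).
  elim: k => [|k IH]; first by rewrite /= subrr big_ord0.
  rewrite big_ord_recr /= /fk_increment H0 !mulr1.
  have -> : fk_weight k om * expR (c (Y k om) * H k om) - 1
    = (fk_weight k om - 1) + fk_weight k om * (expR (c (Y k om) * H k om) - 1) by ring.
  by apply: lerD => //; rewrite ler_wpM2l ?fk_weight_ge0 // ler_norm.
rewrite -lee_fin fineK // -sumEFin -(big_mkord xpredT (fun i => (fk_increment i om)%:E)).
by apply: nneseries_lim_ge => i _ _; rewrite lee_fin fk_increment_ge0.
Qed.

End drift.

End feynman_kac.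

(** * Application to realizations of the minimal chain *)

Section realization.
Context {R : realType} {d : measure_display} {Omega : measurableType d} {V : countType}.
Variables (w : V -> V -> R) (mu : V -> R) (P : probability Omega R) (x0 : V).
Variables (Y : nat -> Omega -> V) (H : nat -> Omega -> R).
Hypotheses (w0 : forall x y, 0 <= w x y) (mu0 : forall x, 0 < mu x)
  (wdegE : forall x, (\esum_(y in [set: V]) (w x y)%:E)%E = (wdeg w x)%:E)
  (wdeg_gt0 : forall x, 0 < wdeg w x)
  (real : chain_realization w mu P x0 Y H).

Let p := jprob w.
Let q := jrate w mu.

Let p0 x y : 0 <= p x y. Proof. by rewrite divr_ge0 // ltW. Qed.
Let q_gt0 x : 0 < q x. Proof. exact: divr_gt0. Qed.
Let q0 x : 0 <= q x. Proof. exact/ltW. Qed.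
Let mY k y : measurable (Y k @^-1` [set y]). Proof. by case: real. Qed.
Let mH k : measurable_fun setT (H k). Proof. by case: real. Qed.

(** The realization gives the formula for paths that start at [x0]; for any other path both sides
    vanish because [Y 0 = x0] almost surely. *)
Lemma realization_law n z (s : nat -> R) : (forall i, 0 <= s i) ->
  P (holding_window Y H 0 n z s)
  = ((z 0%N == x0)%:R * (\prod_(0 <= i < n) p (z i) (z i.+1)
     * \prod_(0 <= i < n.+1) expR (- (q (z i) * s i))))%:E.
Proof.
move=> s0; case: real => _ _ P1 lawn; have [z0|z0] := eqVneq (z 0%N) x0.
  by rewrite mul1r !big_mkord -lawn.
have PC : P (~` [set om | Y 0 om = x0]) = 0%E.
  by rewrite probability_setC ?P1 ?subee //; exact: mY.
rewrite mul0r; apply: (@subset_measure0 _ _ _ P _ (~` [set om | Y 0 om = x0])).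
- exact: measurable_holding_window.
- exact/measurableC/mY.
- by move=> om win /= Y0; move/eqP: z0; apply; have [<- _] := win 0%N isT.
- exact: PC.
Qed.

Lemma jrate_esum (u : V -> R) x : (forall y, 0 <= u y) ->
  ((q x)%:E * (\esum_(y in [set: V]) (p x y * u y)%:E)
   = ((mu x)^-1)%:E * \esum_(y in [set: V]) (w x y * u y)%:E)%E.
Proof.
move=> u0; rewrite -!esumZl //; last 3 first.
- by rewrite invr_ge0 ltW.
- by move=> y; rewrite lee_fin mulr_ge0.
- by move=> y; rewrite lee_fin mulr_ge0.
apply: eq_esum => y _; rewrite -!EFinM; congr EFin.
rewrite /q /p /jrate /jprob; field.
by rewrite !gt_eqF.
Qed.

(** Take [c = 0] and [u = 1]. The weight at step [k+1] is then the indicator that [H 0, ..., H k]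
    are positive, and its expectation is the total mass, which stays 1 because the jump kernel is
    stochastic. *)
Lemma holding_times_gt0 : {ae P, forall om, forall k, 0 < H k om}.
Proof.
pose c (x : V) : R := 0; pose u (x : V) : R := 1.
have cq x : c x < q x by exact: q_gt0.
have pu x : ((q x)%:E * (\esum_(y in [set: V]) (p x y * u y)%:E) = (q x)%:E)%E.
  rewrite jrate_esum //; under eq_esum do rewrite mulr1.
  by rewrite wdegE -EFinM mulrC.
have drift x : ((q x)%:E * (\esum_(y in [set: V]) (p x y * u y)%:E)
     <= ((q x - c x) * u x - `|c x| / 2)%:E)%E.
  by rewrite pu /c /u normr0 mul0r !subr0 mulr1.
have u1 x : 1 <= u x by [].
have Kfin := fk_mass_fin_num x0 p0 q0 cq u1 drift.
have mass1 k : (\esum_(x in [set: V]) (fk_mass x0 p q c k x * (u x)%:E) = 1)%E.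
  elim: k => [|k IH].
    rewrite (esumID [set x0]) //; last by move=> x _; rewrite mule_ge0 // ?lee_fin.
    rewrite setTI esum_set1 /= ?eqxx ?mul1e ?lee_fin //.
    by rewrite esum1 ?adde0 // => x [_ /= /eqP /negbTE ->]; exact: mul0e.
  rewrite fk_mass_step // -IH; apply: eq_esum => x _; rewrite pu -EFinM mule1 -[RHS]fineK //.
  by congr EFin; rewrite /c subr0; field; rewrite gt_eqF.
apply: ae_foralln => k.
have PH : P [set om | 0 < H k om] = 1%E.
  apply/eqP; rewrite eq_le probability_le1 /=; last exact: measurable_holding_gt.
  rewrite -(mass1 k).
  have -> : (\esum_(x in [set: V]) (fk_mass x0 p q c k x * (u x)%:E)
     = \int[P]_om (fk_weight Y H c k.+1 om)%:E)%E.
    rewrite (@fk_weight_integral _ _ _ _ P x0 p q) //.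
    - by apply: eq_esum => x _; rewrite /c subr0 divff // gt_eqF.
    - by apply: fk_law_drift => //; exact: realization_law.
  have mpos := measurable_holding_gt (mH k) 0.
  have <- : (\int[P]_om (\1_[set om | (0 < H k om)%R] om)%:E)%E = P [set om | 0 < H k om].
    by rewrite integral_indic ?setIT.
  apply: ge0_le_integral => //.
  - by move=> om _; rewrite lee_fin fk_weight_ge0.
  - by apply/measurable_EFinP; exact: measurable_fk_weight.
  - by apply/measurable_EFinP/measurable_indic; exact: measurable_holding_gt.
  move=> om _; rewrite lee_fin indicE /=.
  have wle1 j : fk_weight Y H c j om <= 1.
    elim: j => [|j IH] //=; rewrite /c mul0r expR0 mul1r.
    by rewrite mulr_ile1 // ?fk_weight_ge0 //; case: (0 < _).
  have [H0|H0] := ltP 0 (H k om).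
    by rewrite mem_set //= /c mul0r expR0 !mulr1.
  by rewrite !mulr0 /=.
have PC : P (~` [set om | 0 < H k om]) = 0%E.
  by rewrite probability_setC ?PH ?subee //; exact: measurable_holding_gt.
exists (~` [set om | 0 < H k om]); split => //.
by apply: measurableC; exact: measurable_holding_gt.
Qed.

Lemma additive_functional_bounded (c u : V -> R) :
  (forall x, c x < q x) -> (forall x, 1 <= u x) ->
  (forall x, (((mu x)^-1)%:E * (\esum_(y in [set: V]) (w x y * u y)%:E)
     <= ((q x - c x) * u x - `|c x| / 2)%:E)%E) ->
  exists T : Omega -> R, measurable_fun setT T /\
    {ae P, forall om, forall k, \sum_(i < k) c (Y i om) * H i om <= T om}.
Proof.
(* The bound is the total variation of [Z]; where it is infinite, on a null set, [fine] returns
   0. *)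
move=> cq u1 drift; exists (fine \o fk_variation Y H c); split.
  apply: measurableT_comp => //; exact: measurable_fk_variation.
have drift' x : ((q x)%:E * (\esum_(y in [set: V]) (p x y * u y)%:E)
     <= ((q x - c x) * u x - `|c x| / 2)%:E)%E.
  by rewrite jrate_esum // => y; exact: le_trans (u1 y).
have := fk_variation_fin p0 q0 cq mY mH realization_law u1 drift'.
apply: filterS2 holding_times_gt0 => om H0 Vfin; exact: fk_sum_le_variation.
Qed.

End realization.

(** * Occupation time and time change *)

Section time_change_bound.
Context {R : realType} {Omega : Type} {V : choiceType}.
Variables (Y : nat -> Omega -> V) (H : nat -> Omega -> R) (B : set V) (om : Omega).
Hypotheses (H0 : forall k, 0 < H k om) (nexp : ~ explodes H om).

Let J k := jtime H k om.
Let A := [set u : R | chain_in Y H B om u].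
Let on k : R := \sum_(i < k) (Y i om \in B)%:R * H i om.

Lemma jtime0 : J 0 = 0. Proof. by rewrite /J /jtime big_ord0. Qed.

Lemma jtimeS k : J k.+1 = J k + H k om.
Proof. by rewrite /J /jtime big_ord_recr. Qed.

Lemma jtime_ge0 k : 0 <= J k.
Proof. by apply: sumr_ge0 => i _; exact: ltW. Qed.

Lemma measurable_chain_in : measurable A.
Proof.
have -> : A = \bigcup_(k in [set k | B (Y k om)]) `[J k, J k.+1[%classic.
  apply/seteqP; split=> s.
    by move=> [k [Js BY]]; exists k => //=; rewrite in_itv.
  by move=> [k /= BY]; rewrite in_itv /= => Js; exists k.
by apply: bigcup_measurable => k _; exact: measurable_itv.
Qed.

Lemma jtime_locate (s : R) : 0 <= s -> exists k, J k <= s < J k.+1.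
Proof.
move=> s0.
have ex : exists k, s < J k.
  apply: contrapT => /forallNP nex; apply: nexp; exists s => k.
  by rewrite leNgt; apply/negP; exact: nex.
case: (ex_minnP ex) => -[|k] sk kmin; first by move: sk; rewrite jtime0 ltNge s0.
exists k; rewrite sk andbT leNgt; apply/negP => /kmin.
by rewrite ltnn.
Qed.

(** Up to [s] in the [k]-th sojourn, the occupation is at least that before [J k] plus the elapsed
    part of the sojourn if its state lies in [B]. *)
Lemma occupation_split k (s : R) : J k <= s <= J k.+1 ->
  (lebesgue_measure (A `&` `[0%R, J k[) + ((Y k om \in B)%:R * (s - J k))%:E
   <= lebesgue_measure (A `&` `[0%R, s[))%E.
Proof.
move=> /andP[Js sJ].
have -> : A `&` `[0%R, s[ = (A `&` `[0%R, J k[) `|` (A `&` `[J k, s[).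
  rewrite -setIUr; congr (_ `&` _); rewrite -(@itv_bndbnd_setU _ _ _ (BLeft (J k))) //.
  by rewrite bnd_simp jtime_ge0.
have mA := measurable_chain_in.
rewrite measureU; [|by apply: measurableI|by apply: measurableI|]; last first.
  apply/seteqP; split=> u //=; rewrite !in_itv /= => -[[_ /andP[_ uJ]] [_ /andP[Ju _]]].
  by move: (le_lt_trans Ju uJ); rewrite ltxx.
apply: leeD => //; have [BY|_] := boolP (Y k om \in B); last by rewrite mul0r measure_ge0.
rewrite (_ : A `&` `[J k, s[ = `[J k, s[%classic).
  rewrite [X in (_ <= X)%E](lebesgue_measure_itv (Interval (BLeft (J k)) (BLeft s))) /=.
  rewrite lte_fin mul1r.
  by case: ltgtP Js => [||->] // _; rewrite subrr.
apply/seteqP; split=> u; first by case.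
move=> ui; split=> //; exists k; split; last exact: set_mem.
move: ui; rewrite /= in_itv /= => /andP[-> us]; exact: lt_le_trans sJ.
Qed.

Lemma on_le_occupation k : ((on k)%:E <= lebesgue_measure (A `&` `[0%R, J k[))%E.
Proof.
elim: k => [|k IH]; first by rewrite /on big_ord0 measure_ge0.
have /occupation_split : J k <= J k.+1 <= J k.+1 by rewrite lexx jtimeS lerDl ltW.
apply: le_trans; rewrite /on big_ord_recr /= EFinD; apply: leeD => //.
by rewrite jtimeS addrAC subrr add0r.
Qed.

(** The additive functional is [J - 5 on]. At [s = 6 t + e] its bound by [t] forces an occupation of
    at least [(s - t) / 5 = t + e / 5 > t]; the margin [e] gives the strict inequality in the time
    change. *)
Lemma time_change_le (T t : R) : 0 < t -> T <= t ->
  (forall k, \sum_(i < k) (if Y i om \in B then - 4 else 1) * H i om <= T) ->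
  (time_change Y H B om t <= (6 * t)%:E)%E.
Proof.
move=> t0 Tt ST; apply/lee_addgt0Pr => e e0; apply: ereal_inf_lbound.
pose s := 6 * t + e; exists s; last by rewrite -EFinD.
have s0 : 0 < s by rewrite addr_gt0 // mulr_gt0.
split=> //; rewrite /occupation integral_indic //; last exact: measurable_chain_in.
have [k /andP[Js sJ]] := jtime_locate (ltW s0).
apply: (@lt_le_trans _ _ (lebesgue_measure (A `&` `[0%R, s[))); last first.
  apply: le_measure; rewrite ?inE.
  - by apply: measurableI => //; exact: measurable_chain_in.
  - by apply: measurableI => //; exact: measurable_chain_in.
  - by apply: setIS => u /=; rewrite !in_itv /= => /andP[-> /ltW].
have /occupation_split : J k <= s <= J k.+1 by rewrite Js ltW.
apply: lt_le_trans; apply: (@lt_le_trans _ _ ((on k)%:E + ((Y k om \in B)%:R * (s - J k))%:E)%E).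
  have SE j : \sum_(i < j) (if Y i om \in B then - 4 else 1) * H i om = J j - 5 * on j.
    rewrite /J /jtime /on mulr_sumr -sumrB; apply: eq_bigr => i _.
    by case: ifP => _; rewrite /=; ring.
  (* If the state at time [s] lies in [B], the functional has decreased since [J k] and the bound at
     [k] is used; otherwise it increases up to [J k.+1 > s] and the bound at [k+1] is used. *)
  have := ST k.+1; have := ST k; rewrite !SE jtimeS /on big_ord_recr /= -/(on k).
  rewrite jtimeS in sJ; rewrite -EFinD lte_fin.
  have := H0 k; case: (Y k om \in B) => /=; rewrite /s in Js sJ *; lra.
by apply: leeD => //; exact: on_le_occupation.
Qed.

End time_change_bound.

(** * Drift inequality on the modified graph *)

Section modified_graph.
Context {R : realType} {Vo : countType}.
Variables (wo : Vo -> Vo -> R) (muo : Vo -> R) (sigmao : Vo -> Vo -> R)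
  (pos : rel Vo) (nn : Vo -> Vo -> nat).
Hypotheses (graph : simple_weighted_graph wo muo) (adapted : adapted_weight wo muo sigmao)
  (orient : orientation wo pos)
  (nn2 : forall x y, 0 < wo x y -> nn x y = nn y x /\ (2 <= nn x y)%N).

Local Notation V := (mvert pos nn).
Local Notation w := (mw wo pos nn).
Local Notation mu := (mmu wo muo sigmao pos nn).

(* Quadratic in [i] with second difference [- 4 sigma^2 / n^2], and equal to [1]
   at both ends of the edge. *)
Definition edge_pot (x y : Vo) (i : nat) : R :=
  1 + 2 * sigmao x y ^+ 2 * (i%:R * ((nn x y)%:R - i%:R)) / (nn x y)%:R ^+ 2.

Definition pot (v : V) : R :=
  match val v with inl _ => 1 | inr (x, y, i) => edge_pot x y i end.

Let wo0 x y : 0 <= wo x y. Proof. by case: graph => _ [_ []]. Qed.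
Let wo_sym x y : wo x y = wo y x. Proof. by case: graph => _ []. Qed.
Let muo_gt0 x : 0 < muo x. Proof. by case: graph => _ [_ [_ []]]. Qed.
Let woxx x : wo x x = 0. Proof. by case: graph => _ [_ [_ [_ []]]]. Qed.

Lemma posW x y : pos x y -> [/\ 0 < wo x y, x != y, (2 <= nn x y)%N & 0 < sigmao x y <= 1].
Proof.
move=> pxy; have w0 := orient.1 _ _ pxy; split => //.
- by apply: contraTneq w0 => ->; rewrite woxx ltxx.
- by have [] := nn2 w0.
- by case: adapted => _ /(_ _ _ w0).
Qed.

Lemma mw_ge0 u v : 0 <= w u v.
Proof.
rewrite /mw; case: (val u) => [a|[[x y] i]]; case: (val v) => [b|[[x' y'] j]] //=;
  by case: ifP => // _; rewrite mulr_ge0.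
Qed.

Lemma mmu_gt0 v : 0 < mu v.
Proof.
rewrite /mmu; case: v => -[a|[[x y] i]] //= /andP[/posW[w0 _ n2 /andP[s0 _]] _].
by rewrite divr_gt0 ?mulr_gt0 ?exprn_gt0 // ltr0n (leq_trans _ n2).
Qed.

(** [i (n - i) <= n^2 / 4], by [(n - 2 i)^2 >= 0], and [sigma <= 1] keep the excess over 1 below
    [1 / 2]. *)
Lemma edge_pot_bounds x y i : pos x y -> (0 < i < nn x y)%N ->
  1 <= edge_pot x y i <= 3 / 2.
Proof.
move=> /posW[_ _ n2 /andP[s0 s1]] /andP[i0 i_n].
have n0 : 0 < (nn x y)%:R :> R by rewrite ltr0n (leq_trans _ n2).
have in' : i%:R <= (nn x y)%:R :> R by rewrite ler_nat ltnW.
have i0' : 0 <= i%:R :> R by [].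
rewrite /edge_pot lerDl; apply/andP; split.
  by rewrite divr_ge0 ?mulr_ge0 ?exprn_ge0 ?subr_ge0 // ltW.
have -> : 3 / 2 = 1 + 1 / 2 :> R by field.
rewrite lerD2l ler_pdivrMr ?exprn_gt0 //.
have s2 : sigmao x y ^+ 2 <= 1 by rewrite expr_le1 // ltW.
have b0 : 0 <= i%:R * ((nn x y)%:R - i%:R) :> R by rewrite mulr_ge0 ?subr_ge0.
apply: (@le_trans _ _ (2 * 1 * (i%:R * ((nn x y)%:R - i%:R)))).
  by rewrite ler_wpM2r // ler_wpM2l.
have := sqr_ge0 ((nn x y)%:R - 2 * i%:R : R); nra.
Qed.

Lemma pot_ge1 v : 1 <= pot v.
Proof.
rewrite /pot; case: v => -[a|[[x y] i]] //= /andP[pxy ii].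
by case/andP: (edge_pot_bounds pxy ii).
Qed.

(** The neighbours are the adjacent points of the path, with indices 0 and [n] read as the original
    endpoints. As [edge_pot] is 1 there, one quadratic formula gives the second difference in all
    cases. *)
Lemma subdivision_neighbours (v : V) x y i : val v = inr (x, y, i) ->
  exists l r : V, [/\ l != r, w v l = (nn x y)%:R * wo x y, w v r = (nn x y)%:R * wo x y,
    (forall v', v' != l -> v' != r -> w v v' = 0) &
    pot l + pot r = 2 * pot v - 4 * sigmao x y ^+ 2 / (nn x y)%:R ^+ 2].
Proof.
move=> vE; have : mvalid pos nn (val v) by exact: valP.
rewrite vE /= => /andP[pxy /andP[i0 i_n]].
have [w0 xy n2 _] := posW pxy.
pose rl : Vo + (Vo * Vo * nat) := if i == 1%N then inl x else inr (x, y, i.-1).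
pose rr : Vo + (Vo * Vo * nat) := if i == (nn x y).-1 then inl y else inr (x, y, i.+1).
have vl : mvalid pos nn rl.
  rewrite /rl; case: eqP => //= i1; rewrite pxy /=; apply/andP; split.
    by case: (i) i0 i1 => [|[]].
  exact: leq_ltn_trans (leq_pred _) i_n.
have vr : mvalid pos nn rr.
  rewrite /rr; case: eqP => //= i1; rewrite pxy /=.
  by rewrite ltn_neqAle i_n andbT; apply: contra_notN i1 => /eqP <-.
exists (exist _ rl vl : V), (exist _ rr vr : V); split.
(* When [n = 2] both neighbours are original, and they differ because there are no loops. *)
- rewrite -val_eqE /= /rl /rr; case: ifP => _; case: ifP => _ //=.
  by apply/eqP => -[] /eqP; rewrite ltn_eqF // ltnS leq_pred.
- rewrite /mw vE /= /rl; case: eqP => [->|i1] /=; first by rewrite !eqxx.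
  by rewrite !eqxx /= prednK // eqxx.
- rewrite /mw vE /= /rr; case: eqP => [->|i1] /=; first by rewrite !eqxx orbT.
  by rewrite !eqxx /= orbT.
- move=> v'; rewrite -!val_eqE /= /mw vE /=.
  case: v' => -[a|[[x' y'] j]] /= vv'.
    case: ifP => // /orP[] /andP[/eqP -> /eqP ii]; rewrite /rl /rr ii eqxx.
      by move=> /eqP.
    by move=> _ /eqP.
  case/andP: vv' => pxy' /andP[j0 jn]; case: ifP => //.
  move=> /andP[/andP[/eqP xx' /eqP yy']]; subst x' y'; rewrite /rl /rr => /orP[] /eqP ij; subst.
    by rewrite eqSS (gtn_eqF j0) => /eqP.
  by rewrite (_ : (i == (nn x y).-1) = false) => [_ /eqP|] //; apply/eqP; lia.
- have n0 : (nn x y)%:R != 0 :> R by rewrite pnatr_eq0 -lt0n (leq_trans _ n2).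
  rewrite /pot vE /=.
  have -> : (match rl with inl _ => 1 | inr (a, b, j) => edge_pot a b j end) = edge_pot x y i.-1.
    by rewrite /rl; case: eqP => // ->; rewrite /edge_pot mul0r mulr0 mul0r addr0.
  have -> : (match rr with inl _ => 1 | inr (a, b, j) => edge_pot a b j end) = edge_pot x y i.+1.
    rewrite /rr; case: eqP => // ->; rewrite /edge_pot prednK ?subrr ?mulr0 ?mul0r ?addr0 //.
    exact: leq_trans n2.
  rewrite /edge_pot; have -> : i.+1%:R = i%:R + 1 :> R by rewrite -natr1.
  have -> : i.-1%:R = i%:R - 1 :> R by rewrite -[in RHS](prednK i0) -natr1 addrK.
  by field.
Qed.

Lemma subdivision_esum (v : V) x y i : val v = inr (x, y, i) ->
  exists l r : V, pot l + pot r = 2 * pot v - 4 * sigmao x y ^+ 2 / (nn x y)%:R ^+ 2 /\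
    forall g : V -> R, (forall v', 0 <= g v') ->
      (\esum_(v' in [set: V]) (w v v' * g v')%:E)%E
      = ((nn x y)%:R * wo x y * (g l + g r))%:E.
Proof.
move=> /subdivision_neighbours[l [r [lr wl wr w0 potE]]]; exists l, r; split=> // g g0.
have wg0 v' : (0 <= (w v v' * g v')%:E)%E by rewrite lee_fin mulr_ge0 ?mw_ge0.
rewrite (esumID [set l]) // !setTI esum_set1 // (esumID [set r] (~` [set l])) //.
rewrite (_ : ~` [set l] `&` [set r] = [set r]) ?esum_set1 //; last first.
  by apply/seteqP; split=> v' /= => [[]//|->]; split=> // /esym/eqP; rewrite (negbTE lr).
rewrite esum1 ?adde0 -?EFinD ?wl ?wr -?mulrDr // => v' [/= /eqP l' /eqP r'].
by rewrite w0 // mul0r.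
Qed.

(** * Neighbourhood of an original vertex *)

Section original_vertex.
Variables (v : V) (a : Vo).
Hypothesis va : val v = inl a.

Let N : set V := [set v' | w v v' != 0].

(** For a neighbour of [a], the endpoint opposite to [a] of the original edge carrying it; the [inl]
    branch is a default value. *)
Definition far_end (v' : V) : Vo :=
  match val v' with
  | inl b => b
  | inr (x, y, i) => if (a == x) && (i == 1)%N then y else x
  end.

Lemma original_neighbour v' : N v' -> exists x y i,
  [/\ val v' = inr (x, y, i), pos x y, w v v' = (nn x y)%:R * wo x y &
    [/\ a = x, i = 1%N & far_end v' = y] \/ [/\ a = y, i = (nn x y).-1 & far_end v' = x]].
Proof.
rewrite /N /= /mw va /far_end; case: v' => -[b|[[x y] i]] /= vv'; first by rewrite eqxx.
case/andP: vv' => pxy _; have [_ xy _ _] := posW pxy.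
case: ifP => [|_]; last by rewrite eqxx.
move=> cond _; exists x, y, i; split=> //.
case/orP: cond => /andP[/eqP ax /eqP ii]; subst.
  by left; rewrite !eqxx.
by right; split=> //; rewrite eq_sym (negbTE xy).
Qed.

(** The orientation keeps only one of [(a, y)] and [(y, a)], so each original edge at [a] carries a
    single neighbour of [a]. *)
Lemma far_end_inj : set_inj N far_end.
Proof.
move=> v1 v2 /set_mem /original_neighbour[x1 [y1 [i1 [E1 p1 _ C1]]]].
move=> /set_mem /original_neighbour[x2 [y2 [i2 [E2 p2 _ C2]]]] eqf.
have asym x y : pos x y -> pos y x -> False.
  by move=> pxy pyx; have := orient.2 x y (orient.1 _ _ pxy); rewrite pxy pyx.
apply: val_inj; rewrite E1 E2.
move: p1 p2 eqf; case: C1 => -[a1 j1 ->]; case: C2 => -[a2 j2 ->] p1 p2 eqf; subst => //.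
- by case: (asym _ _ p1 p2).
- by case: (asym _ _ p1 p2).
Qed.

Lemma original_finite : finite_set N.
Proof.
have finE : finite_set [set y | wo a y != 0] by case: graph => _ [_ [_ [_ [_ []]]]].
have sub : far_end @` N `<=` [set y | wo a y != 0].
  move=> _ [v' /original_neighbour[x [y [i [_ pxy _ C]]]] <-] /=.
  have [w0 _ _ _] := posW pxy; apply: lt0r_neq0.
  by case: C => -[-> _ ->] //; rewrite wo_sym.
by rewrite -(eq_finite_set (inj_card_eq far_end_inj)); exact: sub_finite_set finE.
Qed.

Lemma original_esum_fin : (\esum_(v' in [set: V]) (w v v')%:E)%E \is a fin_num.
Proof.
have -> : (\esum_(v' in [set: V]) (w v v')%:E = \esum_(v' in N) (w v v')%:E)%E.
  rewrite [RHS]esum_mkcond; apply: eq_esum => v' _; case: ifPn => //.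
  by rewrite notin_setE /N /= => /negP; rewrite negbK => /eqP ->.
rewrite esum_fset; last 2 first.
- exact: original_finite.
- by move=> v' _; rewrite lee_fin mw_ge0.
by rewrite fsumEFin //; exact: original_finite.
Qed.

(** Since [Vo] is infinite, there is a second vertex, and connectedness yields an edge at [a]. Its
    subdivision vertex next to [a] has index 1 or [n - 1], depending on the orientation. *)
Lemma original_esum_gt0 : (0 < \esum_(v' in [set: V]) (w v v')%:E)%E.
Proof.
have [b ba] : exists b, b != a.
  apply: contrapT => /forallNP nb; case: graph => inf _; apply: inf.
  apply: (@sub_finite_set _ _ [set a]); last exact: finite_set1.
  by move=> b _ /=; apply/eqP; rewrite -[_ == _]negbK; apply/negP; exact: nb.
have [y wy] : exists y, 0 < wo a y.
  case: graph => _ [_ [_ [_ [_ [_ /(_ a b)[[|y s] /= [+ lst]]]]]]].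
    by move: ba; rewrite -lst eqxx.
  by move=> /andP[wy _]; exists y.
have [v' wv'] : exists v', 0 < w v v'.
  have [nE n2] := nn2 wy; have n0 : (0 < nn a y)%N by exact: leq_trans n2.
  have := orient.2 _ _ wy; case: (boolP (pos a y)) => [pay _|_ /esym/negbFE pya].
    have vv' : mvalid pos nn (inr (a, y, 1%N)) by rewrite /= pay.
    exists (exist (fun u => mvalid pos nn u) _ vv'); rewrite /mw va /= !eqxx /=.
    by rewrite mulr_gt0 // ltr0n.
  have vv' : mvalid pos nn (inr (y, a, (nn y a).-1)).
    by rewrite /= pya -nE; case: (nn a y) n2 => [|[|n]] //= _; rewrite ltnS leqnn.
  exists (exist (fun u => mvalid pos nn u) _ vv'); rewrite /mw va /= !eqxx /= orbT.
  by rewrite mulr_gt0 ?ltr0n -?nE // wo_sym.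
apply: (@lt_le_trans _ _ (w v v')%:E); first by rewrite lte_fin.
by apply: esum_ge; exists [set v']; [split|rewrite fsbig_set1].
Qed.

(** A neighbour has edge weight [n w] and excess potential [2 sigma^2 (n - 1) / n^2], so it
    contributes at most [2 w sigma^2]. By adaptedness these contributions sum to at most [2 mu]. *)
Lemma original_drift :
  (((mu v)^-1)%:E * (\esum_(v' in [set: V]) (w v v' * pot v')%:E)
   <= (jrate w mu v + 2)%:E)%E.
Proof.
have mua : mu v = muo a by rewrite /mmu va.
have wE : (\esum_(v' in [set: V]) (w v v')%:E)%E = (wdeg w v)%:E.
  by rewrite fineK //; exact: original_esum_fin.
pose h y := wo a y * sigmao a y ^+ 2.
have h0 y : 0 <= h y by rewrite mulr_ge0 // sqr_ge0.
have hmu : (\esum_(y in [set: Vo]) (h y)%:E <= (muo a)%:E)%E.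
  case: adapted => _ _ /(_ a) /(@lee_wpmul2l _ (muo a)%:E) K.
  have /K : (0 <= (muo a)%:E)%E by rewrite lee_fin ltW.
  by rewrite muleA -EFinM mulfV ?gt_eqF // mul1e mule1.
have le1 : (\esum_(v' in [set: V]) (w v v' * pot v')%:E
    <= (wdeg w v)%:E + 2%:E * (muo a)%:E)%E.
  apply: (@le_trans _ _ (\esum_(v' in [set: V]) ((w v v')%:E
     + (if v' \in N then (2 * h (far_end v'))%:E else 0)))%E).
    apply: le_esum => v' _; case: ifPn => [/set_mem Nv'|]; last first.
      by rewrite notin_setE /N /= => /negP; rewrite negbK => /eqP ->; rewrite mul0r adde0.
    have [x [y [i [E pxy -> C]]]] := original_neighbour Nv'.
    have [w0 _ n2 /andP[s0 _]] := posW pxy.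
    have n0 : 0 < (nn x y)%:R :> R by rewrite ltr0n (leq_trans _ n2).
    have hE : h (far_end v') = wo x y * sigmao x y ^+ 2.
      rewrite /h; case: C => -[-> _ ->] //; rewrite wo_sym.
      by case: adapted => sym _ _; rewrite (sym _ _ w0).
    have pE : pot v' = 1 + 2 * sigmao x y ^+ 2 * ((nn x y)%:R - 1) / (nn x y)%:R ^+ 2.
      rewrite /pot E /edge_pot; case: C => -[_ -> _]; first by rewrite mul1r.
      have -> : (nn x y).-1%:R = (nn x y)%:R - 1 :> R.
        by rewrite -[in RHS](@prednK (nn x y)) ?(leq_trans _ n2) // -natr1 addrK.
      by rewrite opprB addrCA subrr addr0 mulr1.
    rewrite hE pE -EFinD lee_fin mulrDr mulr1 lerD2l -subr_ge0.
    have -> : 2 * (wo x y * sigmao x y ^+ 2) - (nn x y)%:R * wo x y *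
        (2 * sigmao x y ^+ 2 * ((nn x y)%:R - 1) / (nn x y)%:R ^+ 2)
      = 2 * wo x y * sigmao x y ^+ 2 / (nn x y)%:R by field; rewrite gt_eqF.
    by rewrite divr_ge0 ?mulr_ge0 ?sqr_ge0 // ltW.
  rewrite esumD; last 2 first.
  - by move=> v' _; rewrite lee_fin mw_ge0.
  - by move=> v' _; case: ifP => // _; rewrite lee_fin mulr_ge0.
  rewrite wE; apply: leeD => //; rewrite -esum_mkcond.
  under eq_esum do rewrite EFinM.
  rewrite esumZl //; last by move=> v'; rewrite lee_fin.
  apply: lee_wpmul2l; first by rewrite lee_fin.
  (* Injectivity of [far_end] makes this a sum over distinct original vertices, to be extended to
     all of [Vo]. *)
  rewrite -(@esum_image _ _ _ N far_end (fun y => (h y)%:E)); last exact: far_end_inj.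
  apply: le_trans hmu; rewrite esum_mkcond; apply: le_esum => y _.
  by case: ifP => // _; rewrite lee_fin.
have mu0 : 0 < mu v by exact: mmu_gt0.
apply: (@le_trans _ _ ((mu v)^-1 * (wdeg w v + 2 * muo a))%:E).
  rewrite EFinM EFinD EFinM; apply: lee_wpmul2l => //.
  by rewrite lee_fin invr_ge0 ltW.
rewrite lee_fin /jrate -mua le_eqVlt; apply/orP; left; apply/eqP.
by field; rewrite gt_eqF.
Qed.

End original_vertex.

(** * Rates and drift at all vertices *)

Definition cost (v : V) : R := if v \in in_Vo pos nn then - 4 else 1.

Lemma cost_original (v : V) a : val v = inl a -> cost v = - 4.
Proof. by move=> va; rewrite /cost mem_set //; exists a. Qed.

Lemma cost_subdivision (v : V) e : val v = inr e -> cost v = 1.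
Proof. by move=> ve; rewrite /cost memNset // => -[a]; rewrite ve. Qed.

Lemma subdivision_wdeg (v : V) x y i : val v = inr (x, y, i) ->
  (\esum_(v' in [set: V]) (w v v')%:E)%E = (2 * ((nn x y)%:R * wo x y))%:E.
Proof.
move=> /subdivision_esum[l [r [_ /(_ (fun=> 1) (fun=> ler01))]]].
by under eq_esum do rewrite mulr1; move=> ->; congr EFin; ring.
Qed.

Lemma mw_wdeg v : (\esum_(v' in [set: V]) (w v v')%:E)%E = (wdeg w v)%:E.
Proof.
rewrite fineK //; case vE : (val v) => [a|[[x y] i]]; first exact: original_esum_fin vE.
by rewrite (subdivision_wdeg vE).
Qed.

Lemma mw_wdeg_gt0 v : 0 < wdeg w v.
Proof.
rewrite -lte_fin -mw_wdeg; case vE : (val v) => [a|[[x y] i]].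
  exact: original_esum_gt0 vE.
have : mvalid pos nn (val v) by exact: valP.
rewrite (subdivision_wdeg vE) vE /= => /andP[/posW[w0 _ n2 _] _].
by rewrite lte_fin !mulr_gt0 // ltr0n (leq_trans _ n2).
Qed.

Lemma subdivision_jrate (v : V) x y i : val v = inr (x, y, i) ->
  jrate w mu v = (nn x y)%:R ^+ 2 / sigmao x y ^+ 2.
Proof.
move=> vE; have : mvalid pos nn (val v) by exact: valP.
rewrite {1}vE /= => /andP[/posW[w0 _ n2 /andP[s0 _]] _].
have -> : jrate w mu v = (2 * ((nn x y)%:R * wo x y)) / mu v.
  by rewrite /jrate /wdeg (subdivision_wdeg vE).
rewrite /mmu vE; field.
by rewrite !gt_eqF //= ltr0n (leq_trans _ n2).
Qed.

(** On [V_o] the cost is negative; at a subdivision vertex the rate [n^2 / sigma^2] is at least 4,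
    as [n >= 2] and [sigma <= 1]. *)
Lemma cost_lt_jrate v : cost v < jrate w mu v.
Proof.
case vE : (val v) => [a|[[x y] i]].
  rewrite (cost_original vE); apply: (@lt_trans _ _ 0); first by rewrite oppr_lt0.
  by rewrite divr_gt0 ?mw_wdeg_gt0 ?mmu_gt0.
have : mvalid pos nn (val v) by exact: valP.
rewrite (cost_subdivision vE) (subdivision_jrate vE) vE /= => /andP[/posW[_ _ n2 /andP[s0 s1]] _].
have n2' : 2 <= (nn x y)%:R :> R by rewrite (ler_nat R 2).
rewrite ltr_pdivlMr ?exprn_gt0 // mul1r; nra.
Qed.

(** The constants balance exactly. On [V_o], [L u <= 2] and [c u = - 4] give [- 2 = - |c| / 2]; at a
    subdivision vertex, [L u = - 2] and [c u <= 3 / 2] give [- 1 / 2]. *)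
Lemma modified_drift v :
  (((mu v)^-1)%:E * (\esum_(v' in [set: V]) (w v v' * pot v')%:E)
   <= ((jrate w mu v - cost v) * pot v - `|cost v| / 2)%:E)%E.
Proof.
case vE : (val v) => [a|[[x y] i]].
  apply: le_trans (original_drift vE) _.
  rewrite (cost_original vE) /pot vE lee_fin normrN ger0_norm //.
  by rewrite mulr1 opprK; lra.
have : mvalid pos nn (val v) by exact: valP.
rewrite {1}vE /= => /andP[pxy ii]; have [w0 _ n2 /andP[s0 _]] := posW pxy.
have n0 : 0 < (nn x y)%:R :> R by rewrite ltr0n (leq_trans _ n2).
have [l [r [potE esumE]]] := subdivision_esum vE.
rewrite esumE; last by move=> v'; exact: le_trans (pot_ge1 v').
rewrite potE (cost_subdivision vE) (subdivision_jrate vE) normr1 -EFinM lee_fin.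
have -> : (mu v)^-1 * ((nn x y)%:R * wo x y *
    (2 * pot v - 4 * sigmao x y ^+ 2 / (nn x y)%:R ^+ 2))
  = (nn x y)%:R ^+ 2 / sigmao x y ^+ 2 * pot v - 2.
  by rewrite /mmu vE; field; rewrite !gt_eqF.
have : pot v <= 3 / 2 by rewrite /pot vE; case/andP: (edge_pot_bounds pxy ii).
by rewrite mulrBl mul1r; lra.
Qed.

End modified_graph.

(** * Measurability of explosion and conclusion *)

Lemma explodes_measurable {R : realType} {d : measure_display} {Omega : measurableType d}
    (H : nat -> Omega -> R) :
  (forall k, measurable_fun setT (H k)) -> measurable [set om | explodes H om].
Proof.
move=> mH; have mJ k : measurable_fun setT (jtime H k).
  rewrite (_ : jtime H k = (fun om => \sum_(i < k) H i om)) //.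
  exact: measurable_sum.
(* Restricting the bounds to natural numbers makes the union countable. *)
have -> : [set om | explodes H om]
  = \bigcup_(M : nat) \bigcap_(k : nat) [set om | jtime H k om <= M%:R].
  apply/seteqP; split=> [om [M JM]|om [M _ JM]]; last by exists M%:R => k; exact: JM.
  exists (Num.bound `|M|) => // k _ /=; apply: le_trans (JM k) _.
  by apply: le_trans (ler_norm _) (ltW _); exact: archi_boundP.
apply: bigcup_measurable => M _; apply: bigcap_measurableType => // k _.
rewrite (_ : [set om | _] = jtime H k @^-1` `]-oo, M%:R]).
  by rewrite -[X in measurable X]setTI; exact: mJ.
by apply/seteqP; split=> om /=; rewrite in_itv.
Qed.

Theorem theorem1p12 (R : realType) :
  exists C : R, 1 < C /\
  forall (Vo : countType) (wo : Vo -> Vo -> R) (muo : Vo -> R)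
    (sigmao : Vo -> Vo -> R) (pos : rel Vo) (nn : Vo -> Vo -> nat) (xbar : Vo),
    simple_weighted_graph wo muo ->
    adapted_weight wo muo sigmao ->
    orientation wo pos ->
    (forall x y, 0 < wo x y -> nn x y = nn y x /\ (2 <= nn x y)%N) ->
    conservative (mw wo pos nn) (mmu wo muo sigmao pos nn) ->
    forall (d : measure_display) (Omega : measurableType d) (P : probability Omega R)
      (Y : nat -> Omega -> mvert pos nn) (H : nat -> Omega -> R),
      chain_realization (mw wo pos nn) (mmu wo muo sigmao pos nn) P
        (exist (fun v => mvalid pos nn v) (inl xbar) erefl) Y H ->
      exists T : Omega -> R, measurable_fun setT T /\
        {ae P, forall om, forall t : R, T om <= t ->
            (time_change Y H (in_Vo pos nn) om t <= (C * t)%:E)%E}.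
Proof.
(* With [c = - 4] on [V_o] and 1 elsewhere, elapsed time is at most five times the occupation of
   [V_o] plus a random constant; for large [t] that constant is at most [t], whence [5 + 1]. *)
exists 6; split; first by lra.
move=> Vo wo muo sigmao pos nn xbar graph adapted orient nn2 cons d Omega P Y H real.
have mu0 := mmu_gt0 graph adapted orient nn2.
have w0 := mw_ge0 graph (pos := pos) (nn := nn).
have wE := mw_wdeg graph adapted orient nn2.
have wgt0 := mw_wdeg_gt0 graph adapted orient nn2.
have [T0 [mT0 ST0]] := additive_functional_bounded w0 mu0 wE wgt0 real
  (cost_lt_jrate graph adapted orient nn2) (pot_ge1 graph adapted orient nn2)
  (modified_drift graph adapted orient nn2).
have Hgt0 := holding_times_gt0 w0 mu0 wE wgt0 real.
have nexp : {ae P, forall om, ~ explodes H om}.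
  exists [set om | explodes H om]; split; last by move=> om /contrapT.
    by case: real => _ mH _ _; exact: explodes_measurable.
  exact: cons real.
(* The maximum with 1 ensures [t > 0], as the time change bound requires. *)
exists (fun om => Num.max 1 (T0 om)); split; first exact: measurable_maxr.
move: Hgt0 nexp ST0; apply: filterS3 => om H0 ne ST t.
rewrite ge_max => /andP[t1 Tt].
apply: (time_change_le H0 ne _ Tt ST).
exact: lt_le_trans t1.
Qed.
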